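(* Let $(X,d)$ be a proper metric space that admits a conical bicombing. Then there exists a bicombing $s\colon X\times X\times[0,1]\to X$ such that: (1) $s$ is consistent; (2) $s_{xy}(\cdot)$ is a straight geodesic for all $x,y\in X$; (3) the function $t\mapsto d(s_{xy}(t),s_{x'y'}(t))$ is convex on $[0,1]$ for all points $x,y,x',y'\in X$ with $d(x,y)=d(x',y')$.
   Context: A bicombing on $(X,d)$ is any map $\sigma\colon X\times X\times[0,1]\to X$ (no continuity required) such that each $\sigma_{xy}:=\sigma(x,y,\cdot)$ is a geodesic from $x$ to $y$, i.e. $\sigma_{xy}(0)=x$, $\sigma_{xy}(1)=y$, $d(\sigma_{xy}(s),\sigma_{xy}(t))=|s-t|d(x,y)$. It is conical if $d(\sigma_{xy}(t),\sigma_{x'y'}(t))\le(1-t)d(x,x')+t\,d(y,y')$ for all $x,y,x',y'\in X$, $t\in[0,1]$. A bicombing $\sigma$ is consistent if $\sigma_{pq}([0,1])\subset\sigma_{xy}([0,1])$ whenever $p,q\in\sigma_{xy}([0,1])$. A geodesic $c\colon[0,1]\to X$ is straight if $t\mapsto d(z,c(t))$ is convex on $[0,1]$ for every $z\in X$. A metric space is proper if closed bounded sets are compact. *)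

(* Defs.v *)
From Stdlib Require Import Reals List.
Open Scope R_scope.

Record MetricSpace := {
  carrier :> Type;
  mdist : carrier -> carrier -> R;
  dist_refl : forall x y, mdist x y = 0 <-> x = y;
  dist_sym : forall x y, mdist x y = mdist y x;
  dist_tri : forall x y z, mdist x z <= mdist x y + mdist y z
}.

Section Metric.
Variable X : MetricSpace.
Notation d := (mdist X).

Definition in01 (t : R) : Prop := 0 <= t <= 1.

Definition open_set (U : X -> Prop) : Prop :=
  forall x, U x -> exists e, 0 < e /\ forall y, d x y < e -> U y.
Definition closed_set (F : X -> Prop) : Prop :=
  open_set (fun x => ~ F x).
Definition bounded_set (A : X -> Prop) : Prop :=
  exists x0 r, forall x, A x -> d x0 x <= r.
Definition compact_set (K : X -> Prop) : Prop :=
  forall (I : Type) (U : I -> X -> Prop),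
    (forall i, open_set (U i)) ->
    (forall x, K x -> exists i, U i x) ->
    exists l : list I, forall x, K x -> exists i, In i l /\ U i x.
Definition proper : Prop :=
  forall A, closed_set A -> bounded_set A -> compact_set A.

(* c : [0,1] -> X (values outside [0,1] are irrelevant) is a geodesic from x to y *)
Definition geodesic (c : R -> X) (x y : X) : Prop :=
  c 0 = x /\ c 1 = y /\
  forall s t, in01 s -> in01 t -> d (c s) (c t) = Rabs (s - t) * d x y.

Definition bicombing (sigma : X -> X -> R -> X) : Prop :=
  forall x y, geodesic (sigma x y) x y.

Definition conical (sigma : X -> X -> R -> X) : Prop :=
  forall x y x' y' t, in01 t ->
    d (sigma x y t) (sigma x' y' t) <= (1 - t) * d x x' + t * d y y'.

Definition image01 (c : R -> X) (p : X) : Prop := exists t, in01 t /\ c t = p.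

Definition consistent (sigma : X -> X -> R -> X) : Prop :=
  forall x y p q, image01 (sigma x y) p -> image01 (sigma x y) q ->
    forall z, image01 (sigma p q) z -> image01 (sigma x y) z.

Definition convex01 (f : R -> R) : Prop :=
  forall a b l, in01 a -> in01 b -> in01 l ->
    f ((1 - l) * a + l * b) <= (1 - l) * f a + l * f b.

Definition straight (c : R -> X) : Prop :=
  forall z, convex01 (fun t => d z (c t)).

End Metric.

(* Main.v *)
(** A conical bicombing yields a conical midpoint map, which can be made symmetric
    by iterating (x, y) |-> (m x y, m y x).  Call p_0, ..., p_N a chain when each
    interior p_i is the midpoint of its neighbours.  Along two chains with the
    same number of steps, i |-> d(p_i, q_i) is discretely convex; hence a chain is
    determined by its endpoints and its number of steps, is a discrete geodesic,
    and subchains and reversed chains are again chains.  Joining x to y by chains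
    whose step length is about 1/(n+1), so that the number of steps depends on
    d(x, y) alone, and passing to a limit along an ultrafilter on n gives the
    bicombing: subarcs are limits of subchains, whence consistency, and pairs at
    equal distance are joined by chains with equally many steps, whence the
    convexity. *)
From mathcomp Require filter.
From Stdlib Require Import Reals ZArith Lra Lia List Classical ClassicalEpsilon.
Require Import Defs.
Open Scope R_scope.

(** * Ultrafilters on the natural numbers and limits along them *)

Record nonprincipal_ultrafilter (U : (nat -> Prop) -> Prop) : Prop := {
  uf_and : forall P Q : nat -> Prop, U P -> U Q -> U (fun n => P n /\ Q n);
  uf_imp : forall P Q : nat -> Prop, (forall n, P n -> Q n) -> U P -> U Q;
  uf_em : forall P : nat -> Prop, U P \/ U (fun n => ~ P n);
  uf_false : ~ U (fun _ => False);
  uf_cofinal : forall N, U (fun n => (N <= n)%nat)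
}.

(** The filter of eventually true predicates extends to an ultrafilter; containing that filter is
    what gives [uf_cofinal]. *)
Lemma nonprincipal_ultrafilter_exists :
  exists U, nonprincipal_ultrafilter U.
Proof.
  destruct (filter.ultraFilterLemma filter.eventually_filter) as [U [HU Hsub]].
  exists U.
  pose proof (@filter.ultra_proper _ _ HU) as HP.
  pose proof (@filter.filter_filter _ _ HP) as HF.
  split.
  - intros P Q; exact (@filter.filterI _ _ HF P Q).
  - intros P Q; exact (@filter.filterS _ _ HF P Q).
  - intros P; exact (@filter.in_ultra_setVsetC nat U P HU).
  - exact (@filter.filter_not_empty _ _ HP).
  - intros N. apply Hsub. exists N; [exact I|].
    intros n Hn. apply (ssrbool.elimT (@ssrnat.leP _ _)). exact Hn.
Qed.

Section UltrafilterOnNat.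
Variable U : (nat -> Prop) -> Prop.
Hypothesis HU : nonprincipal_ultrafilter U.

Lemma uf_nonempty (P : nat -> Prop) : U P -> exists n, P n.
Proof.
  intros H. apply NNPP; intros C. apply (uf_false _ HU).
  apply (uf_imp _ HU P); [|exact H]. intros n Hn; apply C; eauto.
Qed.

Lemma uf_all (P : nat -> Prop) : (forall n, P n) -> U P.
Proof.
  intros H. apply (uf_imp _ HU (fun n => (0 <= n)%nat)); [auto|].
  apply uf_cofinal, HU.
Qed.

Lemma uf_inv (C e : R) : 0 < e -> U (fun n => C / (INR n + 1) < e).
Proof.
  intros He. destruct (INR_unbounded (C / e)) as [N HN].
  apply (uf_imp _ HU (fun n => (N <= n)%nat)); [|apply uf_cofinal, HU].
  intros n Hn. apply le_INR in Hn. pose proof (pos_INR n).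
  apply Rmult_lt_reg_r with (INR n + 1); [lra|].
  replace (C / (INR n + 1) * (INR n + 1)) with C by (field; lra).
  replace C with (e * (C / e)) at 1 by (field; lra).
  apply Rmult_lt_compat_l; lra.
Qed.

Variable X : MetricSpace.
Notation d := (mdist X).

(** Along one fixed [U] all bounded sequences of a proper space have limits at once, so no
    compatible subsequences have to be chosen for the various [x], [y] and [t]. *)
Definition ulim (u : nat -> X) (l : X) : Prop :=
  forall e, 0 < e -> U (fun n => d (u n) l < e).

Lemma dist_self (x : X) : d x x = 0.
Proof. now apply dist_refl. Qed.

Lemma dist_ge0 (x y : X) : 0 <= d x y.
Proof.
  pose proof (dist_tri X x y x). rewrite dist_self, (dist_sym X y x) in H. lra.
Qed.

Lemma ulim_const (x : X) : ulim (fun _ => x) x.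
Proof. intros e He. apply uf_all; intros _. rewrite dist_self; lra. Qed.

Lemma dist_ball_open (x : X) (r : R) : open_set X (fun y => d y x < r).
Proof.
  intros y Hy. exists (r - d y x). split; [lra|].
  intros z Hz. pose proof (dist_tri X z y x). rewrite (dist_sym X z y) in H. lra.
Qed.

(** Otherwise every point of the closed ball around [x0] is the centre of a ball that [u] avoids on
    a set in [U]. Finitely many of these cover the closed ball, and at an index common to their sets
    [u n] lies in none of them. *)
Lemma ulim_exists (u : nat -> X) (x0 : X) (r : R) :
  proper X -> (forall n, d x0 (u n) <= r) -> exists l, ulim u l.
Proof.
  intros HX Hu. apply NNPP; intros C.
  assert (Hc : compact_set X (fun x => d x0 x <= r)).
  { apply HX; [|now exists x0, r].
    intros x Hx. apply Rnot_le_lt in Hx. exists (d x0 x - r). split; [lra|].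
    intros y Hy. pose proof (dist_tri X x0 y x). rewrite (dist_sym X y x) in H.
    lra. }
  destruct (Hc {p : X * R | ~ U (fun n => d (u n) (fst p) < snd p)}
               (fun i y => d y (fst (proj1_sig i)) < snd (proj1_sig i)))
    as [l Hl].
  - intros i. apply dist_ball_open.
  - intros x _. apply NNPP; intros Cx. apply C. exists x. intros e He.
    apply NNPP; intros Ne. apply Cx. exists (exist _ (x, e) Ne). simpl.
    now rewrite dist_self.
  - assert (Hn : U (fun n => forall i, In i l ->
                    ~ d (u n) (fst (proj1_sig i)) < snd (proj1_sig i))).
    { clear Hl. induction l as [|i l IH].
      - apply uf_all. intros n i [].
      - apply (uf_imp _ HU (fun n => ~ d (u n) (fst (proj1_sig i)) < snd (proj1_sig i) /\
          forall i, In i l -> ~ d (u n) (fst (proj1_sig i)) < snd (proj1_sig i))).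
        + intros n [H1 H2] j [<-|Hj]; auto.
        + apply (uf_and _ HU); [|exact IH].
          destruct (uf_em _ HU (fun n => d (u n) (fst (proj1_sig i)) < snd (proj1_sig i)))
            as [H|H]; [|exact H].
          destruct (proj2_sig i H). }
    destruct (uf_nonempty _ Hn) as [n Hn'].
    destruct (Hl (u n) (Hu n)) as [i [Hi1 Hi2]].
    exact (Hn' i Hi1 Hi2).
Qed.

(** The vanishing term [C / (INR n + 1)] absorbs errors from rounding to chain indices. In the proof
    [e] is a third of the excess: one share for each limit and one for this term. *)
Lemma ulim_dist_le (u v : nat -> X) (l m : X) (B C : R) :
  ulim u l -> ulim v m ->
  (forall n, d (u n) (v n) <= B + C / (INR n + 1)) -> d l m <= B.
Proof.
  intros Hu Hv H. apply Rnot_lt_le; intros Hlt.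
  set (e := (d l m - B) / 3). assert (He : 0 < e) by (unfold e; lra).
  destruct (uf_nonempty _ (uf_and _ HU _ _ (uf_and _ HU _ _ (Hu e He) (Hv e He))
     (uf_inv C e He))) as [n [[H1 H2] H3]].
  specialize (H n). pose proof (dist_tri X l (u n) m) as T1.
  pose proof (dist_tri X (u n) (v n) m) as T2. rewrite (dist_sym X l (u n)) in T1.
  unfold e in *. lra.
Qed.

Lemma ulim_dist_ge (u v : nat -> X) (l m : X) (B C : R) :
  ulim u l -> ulim v m ->
  (forall n, B <= d (u n) (v n) + C / (INR n + 1)) -> B <= d l m.
Proof.
  intros Hu Hv H. apply Rnot_lt_le; intros Hlt.
  set (e := (B - d l m) / 3). assert (He : 0 < e) by (unfold e; lra).
  destruct (uf_nonempty _ (uf_and _ HU _ _ (uf_and _ HU _ _ (Hu e He) (Hv e He))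
     (uf_inv C e He))) as [n [[H1 H2] H3]].
  specialize (H n). pose proof (dist_tri X (u n) l (v n)) as T1.
  pose proof (dist_tri X l m (v n)) as T2. rewrite (dist_sym X m (v n)) in T2.
  unfold e in *. lra.
Qed.

Lemma ulim_of_dist_small (u v : nat -> X) (l : X) :
  ulim u l -> (forall e, 0 < e -> U (fun n => d (u n) (v n) < e)) -> ulim v l.
Proof.
  intros Hu H e He. assert (He2 : 0 < e / 2) by lra.
  apply (uf_imp _ HU (fun n => d (u n) l < e / 2 /\ d (u n) (v n) < e / 2)).
  - intros n [H1 H2]. pose proof (dist_tri X (v n) (u n) l) as T.
    rewrite (dist_sym X (v n) (u n)) in T. lra.
  - apply (uf_and _ HU); auto.
Qed.

(** The hypothesis has the shape supplied by [chain_dist_max], with [a] and [b] the endpoints of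
    varying chains. *)
Lemma ulim_close (u v a b : nat -> X) (l x y : X) :
  ulim u l -> ulim a x -> ulim b y ->
  (forall n, d (u n) (v n) <= Rmax (d (a n) x) (d (b n) y)) ->
  ulim v l.
Proof.
  intros Hu Ha Hb H. apply (ulim_of_dist_small u v l Hu). intros e He.
  apply (uf_imp _ HU (fun n => d (a n) x < e /\ d (b n) y < e)).
  - intros n [H1 H2]. eapply Rle_lt_trans; [apply H|]. now apply Rmax_lub_lt.
  - apply (uf_and _ HU); auto.
Qed.

Lemma ulim_unique (u : nat -> X) (l m : X) : ulim u l -> ulim u m -> l = m.
Proof.
  intros Hl Hm. apply dist_refl. apply Rle_antisym; [|apply dist_ge0].
  apply (ulim_dist_le u u l m 0 0 Hl Hm). intros n. rewrite dist_self.
  unfold Rdiv; rewrite Rmult_0_l; lra.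
Qed.

Lemma ulim_close_rate (u v : nat -> X) (l : X) (C : R) :
  ulim u l -> (forall n, d (u n) (v n) <= C / (INR n + 1)) -> ulim v l.
Proof.
  intros Hu H. apply (ulim_of_dist_small u v l Hu). intros e He.
  apply (uf_imp _ HU (fun n => C / (INR n + 1) < e)); [|now apply uf_inv].
  intros n Hn. specialize (H n). lra.
Qed.

End UltrafilterOnNat.

(** * Symmetrising a conical midpoint map *)

Section SymmetricMidpoint.
Variable U : (nat -> Prop) -> Prop.
Hypothesis HU : nonprincipal_ultrafilter U.
Variable X : MetricSpace.
Notation d := (mdist X).

Record conical_midpoint (m : X -> X -> X) : Prop := {
  mid_l : forall x y, d x (m x y) = d x y / 2;
  mid_r : forall x y, d (m x y) y = d x y / 2;
  mid_conical : forall x y x' y', d (m x y) (m x' y') <= (d x x' + d y y') / 2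
}.

Lemma mid_idem (m : X -> X -> X) (x : X) : conical_midpoint m -> m x x = x.
Proof.
  intros Hm. symmetry. apply dist_refl.
  rewrite (mid_l _ Hm), dist_self. lra.
Qed.

Lemma mid_dist_le (m : X -> X -> X) (z a b : X) :
  conical_midpoint m -> d z (m a b) <= (d z a + d z b) / 2.
Proof.
  intros Hm. rewrite <- (mid_idem m z Hm) at 1. now apply mid_conical.
Qed.

Definition swap_step (m : X -> X -> X) (p : X * X) : X * X :=
  (m (fst p) (snd p), m (snd p) (fst p)).

Definition swap_iter (m : X -> X -> X) (k : nat) (p : X * X) : X * X :=
  Nat.iter k (swap_step m) p.

Lemma swap_iter_S (m : X -> X -> X) (k : nat) (p : X * X) :
  swap_iter m (S k) p = swap_step m (swap_iter m k p).
Proof. reflexivity. Qed.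

(** This makes the limit symmetric as soon as the two components have the same limit. *)
Lemma swap_iter_swap (m : X -> X -> X) (k : nat) (x y : X) :
  swap_iter m k (y, x) =
    (snd (swap_iter m k (x, y)), fst (swap_iter m k (x, y))).
Proof.
  induction k as [|k IH]; [reflexivity|].
  rewrite !swap_iter_S, IH. reflexivity.
Qed.

Lemma swap_iter_ball (m : X -> X -> X) (k : nat) (z : X) (p : X * X) (r : R) :
  conical_midpoint m -> d z (fst p) <= r -> d z (snd p) <= r ->
  d z (fst (swap_iter m k p)) <= r /\ d z (snd (swap_iter m k p)) <= r.
Proof.
  intros Hm H1 H2. induction k as [|k [I1 I2]]; [now split|].
  rewrite !swap_iter_S.
  set (q := swap_iter m k p) in *. unfold swap_step; simpl.
  pose proof (mid_dist_le m z (fst q) (snd q) Hm).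
  pose proof (mid_dist_le m z (snd q) (fst q) Hm). split; lra.
Qed.

Lemma swap_iter_conical (m : X -> X -> X) (k : nat) (p q : X * X) (r : R) :
  conical_midpoint m -> d (fst p) (fst q) <= r -> d (snd p) (snd q) <= r ->
  d (fst (swap_iter m k p)) (fst (swap_iter m k q)) <= r /\
  d (snd (swap_iter m k p)) (snd (swap_iter m k q)) <= r.
Proof.
  intros Hm H1 H2. induction k as [|k [I1 I2]]; [now split|].
  rewrite !swap_iter_S.
  set (a := swap_iter m k p) in *. set (b := swap_iter m k q) in *.
  unfold swap_step; simpl.
  pose proof (mid_conical m Hm (fst a) (snd a) (fst b) (snd b)).
  pose proof (mid_conical m Hm (snd a) (fst a) (snd b) (fst b)). split; lra.
Qed.

(** One step after time [j] both components are midpoints of the pair at time [j], hence within half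
    its gap of the second component; [swap_iter_ball] keeps all later iterates there. *)
Lemma swap_iter_later_ball (m : X -> X -> X) (p : X * X) (j k : nat) :
  conical_midpoint m -> (j < k)%nat ->
  d (snd (swap_iter m j p)) (fst (swap_iter m k p)) <=
    d (fst (swap_iter m j p)) (snd (swap_iter m j p)) / 2.
Proof.
  intros Hm Hjk. replace k with (k - S j + S j)%nat by lia.
  unfold swap_iter at 2. rewrite Nat.iter_add. simpl.
  fold (swap_iter m j p). set (a := swap_iter m j p).
  apply (swap_iter_ball m (k - S j)); [assumption| |]; simpl.
  - rewrite dist_sym, (mid_r _ Hm). lra.
  - rewrite (mid_l _ Hm), dist_sym. lra.
Qed.

(** Conicality bounds the distance from [m a b] to [m b a] by the mean of [d a b] and [d b a]. *)
Lemma swap_iter_gap_mono (m : X -> X -> X) (p : X * X) (j k : nat) :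
  conical_midpoint m -> (j <= k)%nat ->
  d (fst (swap_iter m k p)) (snd (swap_iter m k p)) <=
  d (fst (swap_iter m j p)) (snd (swap_iter m j p)).
Proof.
  intros Hm. induction 1 as [|k _ IH]; [lra|].
  rewrite !swap_iter_S.
  set (a := swap_iter m k p) in *. unfold swap_step; simpl.
  pose proof (mid_conical m Hm (fst a) (snd a) (snd a) (fst a)) as H.
  rewrite (dist_sym X (snd a) (fst a)) in H. lra.
Qed.

(* If the gaps stayed above [e], the first components would form an
   [e/2]-separated bounded sequence, since every later iterate lies within half
   the gap of both components of every earlier one. *)
Lemma swap_iter_gap_small (m : X -> X -> X) (p : X * X) (e : R) :
  proper X -> conical_midpoint m -> 0 < e ->
  U (fun k => d (fst (swap_iter m k p)) (snd (swap_iter m k p)) < e).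
Proof.
  intros HX Hm He.
  assert (Hex : exists k, d (fst (swap_iter m k p)) (snd (swap_iter m k p)) < e).
  { apply NNPP; intros C.
    destruct (ulim_exists U HU X (fun k => fst (swap_iter m k p)) (fst p)
                (d (fst p) (snd p)) HX) as [l Hl].
    { intros k. apply (swap_iter_ball m k (fst p) p); [assumption| |lra].
      rewrite dist_self. apply dist_ge0. }
    assert (He4 : 0 < e / 4) by lra. specialize (Hl _ He4).
    destruct (uf_nonempty U HU _ Hl) as [j Hj].
    destruct (uf_nonempty U HU _ (uf_and _ HU _ _ Hl (uf_cofinal _ HU (S j))))
      as [k [Hk Hjk]].
    pose proof (swap_iter_later_ball m p j k Hm Hjk) as H1.
    assert (H2 : e <= d (fst (swap_iter m j p)) (snd (swap_iter m j p))).
    { apply Rnot_lt_le; intros H2; apply C; eauto. }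
    cbv beta in *.
    set (a := swap_iter m j p) in *. set (b := fst (swap_iter m k p)) in *.
    pose proof (dist_tri X (fst a) b (snd a)) as T1.
    pose proof (dist_tri X (fst a) l b) as T2.
    rewrite (dist_sym X l b) in T2. rewrite (dist_sym X b (snd a)) in T1. lra. }
  destruct Hex as [j Hj].
  apply (uf_imp _ HU (fun k => (j <= k)%nat)); [|apply uf_cofinal, HU].
  intros k Hk. pose proof (swap_iter_gap_mono m p j k Hm Hk). lra.
Qed.

Lemma symmetric_midpoint_exists (m : X -> X -> X) :
  proper X -> conical_midpoint m ->
  exists m', conical_midpoint m' /\ forall x y, m' x y = m' y x.
Proof.
  intros HX Hm.
  (* Starting from the two midpoints instead of [(x, y)] keeps all iterates within [d x y / 2] of
     both [x] and [y]. *)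
  set (u := fun x y k => fst (swap_iter m k (m x y, m y x))).
  assert (Hb : forall x y k, d x (u x y k) <= d x y / 2 /\ d (u x y k) y <= d x y / 2).
  { intros x y k. rewrite (dist_sym X (u x y k) y). split.
    - apply (swap_iter_ball m k); [assumption| |]; simpl.
      + rewrite (mid_l _ Hm); lra.
      + rewrite dist_sym, (mid_r _ Hm), dist_sym; lra.
    - apply (swap_iter_ball m k); [assumption| |]; simpl.
      + rewrite dist_sym, (mid_r _ Hm); lra.
      + rewrite (mid_l _ Hm), dist_sym; lra. }
  assert (He : forall x y, exists l, ulim U X (u x y) l).
  { intros x y. apply (ulim_exists U HU X _ x (d x y / 2) HX). intros k. apply Hb. }
  set (m' := fun x y => proj1_sig (constructive_indefinite_description _ (He x y))).
  assert (Hm' : forall x y, ulim U X (u x y) (m' x y)).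
  { intros x y. unfold m'. now destruct (constructive_indefinite_description _ _). }
  exists m'. split; [split|].
  (* Both distances are at most half of [d x y] and add up to at least [d x y], so both bounds are
     equalities. *)
  1, 2: intros x y;
    assert (d x (m' x y) <= d x y / 2) by
      (apply (ulim_dist_le U HU X _ _ _ _ _ 0 (ulim_const U HU X x) (Hm' x y));
       intros k; unfold Rdiv; rewrite Rmult_0_l, Rplus_0_r; apply Hb);
    assert (d (m' x y) y <= d x y / 2) by
      (apply (ulim_dist_le U HU X _ _ _ _ _ 0 (Hm' x y) (ulim_const U HU X y));
       intros k; unfold Rdiv; rewrite Rmult_0_l, Rplus_0_r; apply Hb);
    pose proof (dist_tri X x (m' x y) y); lra.
  - intros x y x' y'.
    apply (ulim_dist_le U HU X _ _ _ _ _ 0 (Hm' x y) (Hm' x' y')).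
    intros k. unfold Rdiv at 2. rewrite Rmult_0_l, Rplus_0_r.
    apply (swap_iter_conical m k); [assumption| |]; simpl.
    + apply (mid_conical m Hm).
    + pose proof (mid_conical m Hm y x y' x'). lra.
  - intros x y. apply (ulim_unique U HU X (u y x)); [|apply Hm'].
    apply (ulim_of_dist_small U HU X (u x y)); [apply Hm'|].
    intros e Hpos. unfold u.
    apply (uf_imp _ HU (fun k => d (fst (swap_iter m k (m x y, m y x)))
                                   (snd (swap_iter m k (m x y, m y x))) < e)).
    + intros k Hk. rewrite swap_iter_swap with (x := m x y). exact Hk.
    + now apply swap_iter_gap_small.
Qed.

End SymmetricMidpoint.

(** * Chains of iterated midpoints: convexity, uniqueness and existence *)

Section Chains.
Variable U : (nat -> Prop) -> Prop.
Hypothesis HU : nonprincipal_ultrafilter U.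
Variable X : MetricSpace.
Notation d := (mdist X).
Variable m : X -> X -> X.
Hypothesis Hm : conical_midpoint X m.

Definition chain (N : nat) (p : nat -> X) : Prop :=
  forall i, (S i < N)%nat -> p (S i) = m (p i) (p (S (S i))).

(** The chord inequality is multiplied by [INR N] to avoid division. *)
Lemma discrete_convex (f : nat -> R) (N : nat) :
  (forall i, (S i < N)%nat -> 2 * f (S i) <= f i + f (S (S i))) ->
  forall i, (i <= N)%nat -> INR N * f i <= (INR N - INR i) * f 0%nat + INR i * f N.
Proof.
  intros Hf.
  (* Here [f i] is compared with the chord from [0] to [i + 1]; the induction on [N] then lengthens
     the chord by one step at a time. *)
  assert (H1 : forall i, (i < N)%nat ->
            INR (S i) * f i <= f 0%nat + INR i * f (S i)).
  { induction i as [|i IH]; intros Hi.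
    - simpl. lra.
    - specialize (IH ltac:(lia)). specialize (Hf i Hi).
      pose proof (pos_INR i). rewrite !S_INR in *. nra. }
  clear Hf. revert H1. induction N as [|N IH]; intros H1 i Hi.
  - replace i with 0%nat by lia. simpl. lra.
  - destruct (Nat.eq_dec i (S N)) as [->|Hne]; [lra|].
    assert (IH' := IH ltac:(intros; apply H1; lia) i ltac:(lia)).
    destruct N as [|N].
    + replace i with 0%nat by lia. simpl. lra.
    + specialize (H1 (S N) ltac:(lia)).
      apply le_INR in Hi. rewrite (S_INR (S N)) in *.
      pose proof (pos_INR i). set (n := INR (S N)) in *.
      assert (0 < n) by (unfold n; apply lt_0_INR; lia).
      apply Rmult_le_reg_l with n; [assumption|].
      apply Rmult_le_compat_l with (r := n + 1) in IH'; [|lra].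
      apply Rmult_le_compat_l with (r := INR i) in H1; [|assumption].
      lra.
Qed.

Lemma chain_dist_convex (N : nat) (p q : nat -> X) :
  chain N p -> chain N q -> forall i, (i <= N)%nat ->
  INR N * d (p i) (q i) <=
    (INR N - INR i) * d (p 0%nat) (q 0%nat) + INR i * d (p N) (q N).
Proof.
  intros Hp Hq. apply (discrete_convex (fun i => d (p i) (q i))).
  intros i Hi. rewrite (Hp i Hi), (Hq i Hi).
  pose proof (mid_conical _ _ Hm (p i) (p (S (S i))) (q i) (q (S (S i)))). lra.
Qed.

Lemma chain_const (N : nat) (z : X) : chain N (fun _ => z).
Proof. intros i _. now rewrite mid_idem. Qed.

Lemma chain_dist_point_convex (N : nat) (p : nat -> X) (z : X) :
  chain N p -> forall i, (i <= N)%nat ->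
  INR N * d z (p i) <= (INR N - INR i) * d z (p 0%nat) + INR i * d z (p N).
Proof. exact (chain_dist_convex N (fun _ => z) p (chain_const N z)). Qed.

(** For common endpoints this is uniqueness of chains, and in general their stability under moving
    the endpoints. The case [N = 0] is separate because the convexity inequality is void there. *)
Lemma chain_dist_max (N : nat) (p q : nat -> X) :
  chain N p -> chain N q -> forall i, (i <= N)%nat ->
  d (p i) (q i) <= Rmax (d (p 0%nat) (q 0%nat)) (d (p N) (q N)).
Proof.
  intros Hp Hq i Hi. destruct N as [|N].
  - replace i with 0%nat by lia. apply Rmax_l.
  - pose proof (chain_dist_convex (S N) p q Hp Hq i Hi) as H.
    set (M := Rmax _ _).
    assert (H1 : d (p 0%nat) (q 0%nat) <= M) by apply Rmax_l.
    assert (H2 : d (p (S N)) (q (S N)) <= M) by apply Rmax_r.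
    apply le_INR in Hi. pose proof (pos_INR i).
    assert (0 < INR (S N)) by (apply lt_0_INR; lia).
    apply Rmult_le_reg_l with (INR (S N)); [assumption|].
    apply Rmult_le_compat_l with (r := INR (S N) - INR i) in H1; [|lra].
    apply Rmult_le_compat_l with (r := INR i) in H2; lra.
Qed.

Lemma chain_sub (N i K : nat) (p : nat -> X) :
  chain N p -> (i + K <= N)%nat -> chain K (fun j => p (i + j)%nat).
Proof.
  intros Hp H j Hj. rewrite !Nat.add_succ_r. apply Hp. lia.
Qed.

Lemma chain_rev (N : nat) (p : nat -> X) :
  (forall x y, m x y = m y x) -> chain N p -> chain N (fun j => p (N - j)%nat).
Proof.
  intros Hs Hp j Hj. rewrite Hs.
  replace (N - j)%nat with (S (S (N - S (S j)))) by lia.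
  replace (N - S j)%nat with (S (N - S (S j))) by lia.
  apply Hp. lia.
Qed.

(** Midpoints force all steps to have one length [l], so the distance over [j - i] steps is at most
    [(j - i) * l]. Once the whole chain is known to have no shortcut, the triangle inequality makes
    every such bound sharp. *)
Lemma chain_geodesic_le (N : nat) (p : nat -> X) :
  (0 < N)%nat -> chain N p -> forall i j, (i <= j)%nat -> (j <= N)%nat ->
  d (p i) (p j) = (INR j - INR i) * (d (p 0%nat) (p N) / INR N).
Proof.
  intros HN Hp. set (l := d (p 0%nat) (p 1%nat)).
  assert (Hstep : forall i, (i < N)%nat -> d (p i) (p (S i)) = l).
  { induction i as [|i IH]; intros Hi; [reflexivity|].
    rewrite <- IH by lia. rewrite (Hp i Hi) at 1 2.
    now rewrite (mid_l _ _ Hm), (mid_r _ _ Hm). }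
  assert (Hup : forall i j, (i <= j)%nat -> (j <= N)%nat ->
            d (p i) (p j) <= (INR j - INR i) * l).
  { intros i j Hij. induction Hij as [|j Hij IH]; intros Hj.
    - rewrite dist_self. lra.
    - specialize (IH ltac:(lia)). pose proof (dist_tri X (p i) (p j) (p (S j))) as T.
      rewrite (Hstep j) in T by lia. rewrite S_INR. lra. }
  assert (HN0 : 0 < INR N) by (now apply lt_0_INR).
  assert (Hl : INR N * l <= d (p 0%nat) (p N)).
  (* Convexity of the distance from [p 0], read at index 1, excludes a shortcut from [p 0] to
     [p N]. *)
  { pose proof (chain_dist_point_convex N p (p 0%nat) Hp 1 ltac:(lia)) as H.
    rewrite dist_self in H. simpl in H. fold l in H. lra. }
  pose proof (Hup 0%nat N ltac:(lia) ltac:(lia)) as Hl2. simpl in Hl2.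
  assert (E : d (p 0%nat) (p N) / INR N = l).
  { replace (d (p 0%nat) (p N)) with (INR N * l) by lra. field. lra. }
  rewrite E. intros i j Hij Hj. apply Rle_antisym; [now apply Hup|].
  pose proof (Hup 0%nat i ltac:(lia) ltac:(lia)).
  pose proof (Hup j N ltac:(lia) ltac:(lia)). simpl in H.
  pose proof (dist_tri X (p 0%nat) (p i) (p N)).
  pose proof (dist_tri X (p i) (p j) (p N)). lra.
Qed.

Lemma chain_geodesic (N : nat) (p : nat -> X) :
  (0 < N)%nat -> chain N p -> forall i j, (i <= N)%nat -> (j <= N)%nat ->
  d (p i) (p j) = Rabs (INR i - INR j) * (d (p 0%nat) (p N) / INR N).
Proof.
  intros HN Hp i j Hi Hj. destruct (Nat.le_gt_cases i j) as [H|H].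
  - rewrite (chain_geodesic_le N p HN Hp i j H Hj).
    apply le_INR in H. rewrite Rabs_left1 by lra. lra.
  - rewrite dist_sym, (chain_geodesic_le N p HN Hp j i) by lia.
    apply lt_INR in H. rewrite Rabs_right by lra. lra.
Qed.

(** One simultaneous relaxation step, as in the Jacobi iteration for a discrete Dirichlet problem;
    on [0..N] its fixed points are the chains. *)
Definition chain_step (N : nat) (p : nat -> X) (i : nat) : X :=
  match i with
  | 0%nat => p 0%nat
  | S j => if Nat.ltb (S j) N then m (p j) (p (S (S j))) else p (S j)
  end.

Definition chain_iter (N : nat) (x y : X) (k : nat) : nat -> X :=
  Nat.iter k (chain_step N) (fun i => if Nat.ltb i N then x else y).

Lemma chain_iter_S (N : nat) (x y : X) (k i : nat) :
  (S i < N)%nat ->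
  chain_iter N x y (S k) (S i) =
    m (chain_iter N x y k i) (chain_iter N x y k (S (S i))).
Proof.
  intros Hi. unfold chain_iter. simpl.
  apply Nat.ltb_lt in Hi. now rewrite Hi.
Qed.

Lemma chain_iter_0 (N : nat) (x y : X) (k : nat) :
  (0 < N)%nat -> chain_iter N x y k 0 = x.
Proof.
  intros HN. induction k as [|k IH]; [|exact IH].
  unfold chain_iter. simpl. apply Nat.ltb_lt in HN. now rewrite HN.
Qed.

Lemma chain_iter_ge (N : nat) (x y : X) (k i : nat) :
  (0 < N)%nat -> (N <= i)%nat -> chain_iter N x y k i = y.
Proof.
  intros HN Hi. apply Nat.ltb_ge in Hi. induction k as [|k IH].
  - unfold chain_iter. simpl. now rewrite Hi.
  - destruct i as [|i]; [apply Nat.ltb_ge in Hi; lia|].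
    unfold chain_iter in *. simpl. now rewrite Hi.
Qed.

Lemma chain_iter_ball (N : nat) (x y : X) (k i : nat) :
  (0 < N)%nat -> d x (chain_iter N x y k i) <= d x y.
Proof.
  intros HN. revert i. induction k as [|k IH]; intros i.
  - unfold chain_iter. simpl. destruct (Nat.ltb i N); [|lra].
    rewrite dist_self. apply dist_ge0.
  - destruct i as [|i].
    + rewrite chain_iter_0, dist_self by assumption. apply dist_ge0.
    + destruct (Nat.lt_ge_cases (S i) N) as [Hi|Hi].
      * rewrite chain_iter_S by assumption.
        pose proof (mid_dist_le X m x (chain_iter N x y k i)
          (chain_iter N x y k (S (S i))) Hm) as H.
        pose proof (IH i). pose proof (IH (S (S i))). lra.
      * rewrite chain_iter_ge by assumption. lra.
Qed.

(* The weight [i (N - i)] is chosen because the mean of its values at [i - 1]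
   and [i + 1] is [i (N - i) - 1], a definite fraction smaller. *)
Lemma chain_iter_contract (N : nat) (x y : X) (k i : nat) :
  (0 < N)%nat -> (i <= N)%nat ->
  d (chain_iter N x y k i) (chain_iter N x y (S k) i) <=
  2 * d x y * (INR i * (INR N - INR i)) * (1 - / (INR N * INR N)) ^ k.
Proof.
  intros HN. assert (HN1 : 1 <= INR N) by (now apply (le_INR 1)).
  set (q := 1 - _).
  assert (Hinv : 0 < / (INR N * INR N) <= 1).
  { split; [apply Rinv_0_lt_compat; nra|].
    rewrite <- Rinv_1. apply Rinv_le_contravar; nra. }
  assert (Hq : 0 <= q) by (unfold q; lra).
  pose proof (dist_ge0 X x y) as HL.
  revert i. induction k as [|k IH]; intros i Hi.
  - rewrite pow_O, Rmult_1_r.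
    destruct i as [|i].
    { rewrite !chain_iter_0, dist_self by assumption. simpl. lra. }
    destruct (Nat.eq_dec (S i) N) as [->|Hne].
    { rewrite !chain_iter_ge, dist_self by lia. lra. }
    (* Both iterates lie within [d x y] of [x], whence the factor 2; the weight is at least 1 at
       interior indices. *)
    pose proof (chain_iter_ball N x y 0 (S i) HN) as H1.
    pose proof (chain_iter_ball N x y 1 (S i) HN) as H2.
    pose proof (dist_tri X (chain_iter N x y 0 (S i)) x (chain_iter N x y 1 (S i))) as T.
    rewrite (dist_sym X _ x) in T.
    assert (H3 : 1 <= INR (S i)) by (apply (le_INR 1); lia).
    assert (H4 : 1 <= INR N - INR (S i)).
    { rewrite <- minus_INR by lia. apply (le_INR 1); lia. }
    assert (1 <= INR (S i) * (INR N - INR (S i))) by nra. nra.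
  - destruct i as [|i].
    { rewrite !chain_iter_0, dist_self by assumption. simpl. lra. }
    destruct (Nat.eq_dec (S i) N) as [->|Hne].
    { rewrite !chain_iter_ge, dist_self by lia. lra. }
    rewrite !(chain_iter_S N x y _ i) by lia.
    eapply Rle_trans; [apply (mid_conical _ _ Hm)|].
    pose proof (IH i ltac:(lia)) as I1. pose proof (IH (S (S i)) ltac:(lia)) as I2.
    (* The weight is at most [INR N * INR N], so lowering it by 1 lowers it at least by the factor
       [q]. *)
    assert (Hw : INR (S i) * (INR N - INR (S i)) - 1 <=
                 q * (INR (S i) * (INR N - INR (S i)))).
    { set (w := INR (S i) * (INR N - INR (S i))).
      assert (w <= INR N * INR N).
      { unfold w. apply le_INR in Hi. pose proof (pos_INR (S i)). nra. }
      assert (/ (INR N * INR N) * w <= 1).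
      { apply Rmult_le_reg_l with (INR N * INR N); [nra|].
        rewrite <- Rmult_assoc, Rinv_r by nra. lra. }
      unfold q. lra. }
    assert (HA : 0 <= 2 * d x y * q ^ k).
    { pose proof (pow_le q k Hq). nra. }
    apply Rmult_le_compat_l with (r := 2 * d x y * q ^ k) in Hw; [|assumption].
    rewrite !S_INR in *. simpl pow. lra.
Qed.

(** The relaxed sequences stay bounded, so they have limits along [U]. Successive iterates approach
    each other geometrically, hence a shift of [k] leaves the limit unchanged and the limit is fixed
    by relaxation. *)
Lemma chain_exists (N : nat) (x y : X) :
  proper X -> (0 < N)%nat -> exists p, chain N p /\ p 0%nat = x /\ p N = y.
Proof.
  intros HX HN.
  assert (He : forall i, exists l, ulim U X (fun k => chain_iter N x y k i) l).
  { intros i. apply (ulim_exists U HU X _ x (d x y) HX). intros k.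
    now apply chain_iter_ball. }
  set (p := fun i => proj1_sig (constructive_indefinite_description _ (He i))).
  assert (Hp : forall i, ulim U X (fun k => chain_iter N x y k i) (p i)).
  { intros i. unfold p. now destruct (constructive_indefinite_description _ _). }
  exists p. split; [|split].
  - intros i Hi.
    apply (ulim_unique U HU X (fun k => chain_iter N x y (S k) (S i))).
    + apply (ulim_of_dist_small U HU X (fun k => chain_iter N x y k (S i))); [apply Hp|].
      intros e Hpos.
      set (A := 2 * d x y * (INR (S i) * (INR N - INR (S i)))).
      assert (HN1 : 1 <= INR N) by (now apply (le_INR 1)).
      assert (HA : 0 <= A).
      { unfold A. pose proof (dist_ge0 X x y). apply lt_INR in Hi.
        pose proof (pos_INR (S i)).
        assert (0 <= INR (S i) * (INR N - INR (S i))) by nra. nra. }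
      assert (Hq : Rabs (1 - / (INR N * INR N)) < 1).
      { assert (0 < / (INR N * INR N)) by (apply Rinv_0_lt_compat; nra).
        assert (/ (INR N * INR N) <= 1).
        { rewrite <- Rinv_1. apply Rinv_le_contravar; nra. }
        rewrite Rabs_right; lra. }
      (* The denominator is [A + 1] because [A] vanishes when [x = y]. *)
      assert (He' : 0 < e / (A + 1)) by (apply Rdiv_lt_0_compat; lra).
      destruct (pow_lt_1_zero _ Hq _ He') as [K HK].
      apply (uf_imp _ HU (fun k => (K <= k)%nat)); [|apply uf_cofinal, HU].
      intros k Hk. specialize (HK k Hk).
      eapply Rle_lt_trans; [apply chain_iter_contract; lia|]. fold A.
      set (Q := (1 - / (INR N * INR N)) ^ k) in *.
      pose proof (Rle_abs Q) as HQ.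
      apply Rle_lt_trans with (A * (e / (A + 1))); [nra|].
      replace e with ((A + 1) * (e / (A + 1))) at 2 by (field; lra).
      nra.
    + intros e Hpos.
      apply (uf_imp _ HU (fun k => d (chain_iter N x y k i) (p i) < e /\
                d (chain_iter N x y k (S (S i))) (p (S (S i))) < e)).
      * intros k [H1 H2]. rewrite chain_iter_S by assumption.
        eapply Rle_lt_trans; [apply (mid_conical _ _ Hm)|]. lra.
      * apply (uf_and _ HU); now apply Hp.
  - apply (ulim_unique U HU X (fun k => chain_iter N x y k 0)); [apply Hp|].
    intros e Hpos. apply (uf_all U HU). intros k.
    now rewrite chain_iter_0, dist_self.
  - apply (ulim_unique U HU X (fun k => chain_iter N x y k N)); [apply Hp|].
    intros e Hpos. apply (uf_all U HU). intros k.
    now rewrite chain_iter_ge, dist_self.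
Qed.

End Chains.

(** * Rounding real parameters to chain indices *)

Lemma Rabs_le_inv (a b : R) : Rabs a <= b -> - b <= a <= b.
Proof.
  intros H. pose proof (Rle_abs a). pose proof (Rle_abs (- a)) as H1.
  rewrite Rabs_Ropp in H1. lra.
Qed.

Definition nfloor (r : R) : nat := Nat.pred (Z.to_nat (up r)).

Lemma nfloor_spec (r : R) : 0 <= r -> INR (nfloor r) <= r < INR (nfloor r) + 1.
Proof.
  intros Hr. destruct (archimed r) as [H1 H2].
  assert (H3 : (0 < up r)%Z) by (apply lt_IZR; lra).
  assert (E : INR (nfloor r) + 1 = IZR (up r)).
  { unfold nfloor. rewrite <- S_INR, Nat.succ_pred_pos by lia.
    rewrite INR_IZR_INZ, Z2Nat.id by lia. reflexivity. }
  lra.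
Qed.

Lemma nfloor_le (r : R) (N : nat) : 0 <= r <= INR N -> (nfloor r <= N)%nat.
Proof.
  intros [H1 H2]. apply INR_le. pose proof (nfloor_spec r H1). lra.
Qed.

Lemma nfloor_mono (r r' : R) : 0 <= r <= r' -> (nfloor r <= nfloor r')%nat.
Proof.
  intros [H1 H2]. apply Nat.lt_succ_r, INR_lt. rewrite S_INR.
  pose proof (nfloor_spec r H1). pose proof (nfloor_spec r' ltac:(lra)). lra.
Qed.

(* The number of steps of length about [1 / (n + 1)] in a chain of length [L];
   it depends on [L] only, and is positive even for [L = 0]. *)
Definition steps (n : nat) (L : R) : nat := S (nfloor (L * (INR n + 1))).

Lemma steps_spec (n : nat) (L : R) :
  0 <= L -> L * (INR n + 1) < INR (steps n L) <= L * (INR n + 1) + 1.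
Proof.
  intros HL. pose proof (pos_INR n). unfold steps. rewrite S_INR.
  pose proof (nfloor_spec (L * (INR n + 1)) ltac:(nra)). lra.
Qed.

Lemma steps_pos (n : nat) (L : R) : 0 < INR (steps n L).
Proof. apply lt_0_INR. unfold steps. lia. Qed.

Lemma steps_size (n : nat) (L : R) :
  0 <= L -> L / INR (steps n L) <= / (INR n + 1).
Proof.
  intros HL. pose proof (steps_spec n L HL). pose proof (steps_pos n L).
  pose proof (pos_INR n).
  apply Rmult_le_reg_r with (INR (steps n L) * (INR n + 1)); [nra|].
  replace (L / INR (steps n L) * (INR (steps n L) * (INR n + 1)))
    with (L * (INR n + 1)) by (field; lra).
  replace (/ (INR n + 1) * (INR (steps n L) * (INR n + 1)))
    with (INR (steps n L)) by (field; lra).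
  lra.
Qed.

Lemma frac_index (n : nat) (L t : R) :
  in01 t -> (nfloor (t * INR (steps n L)) <= steps n L)%nat /\
  Rabs (INR (nfloor (t * INR (steps n L))) - t * INR (steps n L)) <= 1.
Proof.
  intros [H0 H1]. pose proof (steps_pos n L).
  assert (H2 : 0 <= t * INR (steps n L) <= INR (steps n L)) by nra.
  split; [now apply nfloor_le|].
  pose proof (nfloor_spec _ (proj1 H2)). apply Rabs_le. lra.
Qed.

(** Replacing the index by [t * N] costs at most [Rabs (B - A)], hence [2 * L]; dividing by [N]
    turns this into [2 / (INR n + 1)] by [steps_size]. For distances between the ends of two
    segments of length [L], the bound on [A - B] is the triangle inequality. *)
Lemma interpolation_error (n : nat) (L t A B D : R) :
  0 <= L -> in01 t -> Rabs (A - B) <= 2 * L ->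
  INR (steps n L) * D <=
    (INR (steps n L) - INR (nfloor (t * INR (steps n L)))) * A +
    INR (nfloor (t * INR (steps n L))) * B ->
  D <= (1 - t) * A + t * B + 2 / (INR n + 1).
Proof.
  intros HL Ht HAB H. pose proof (proj2 (frac_index n L t Ht)) as F.
  pose proof (steps_pos n L) as HN. pose proof (steps_size n L HL) as HS.
  set (N := INR (steps n L)) in *. set (i := INR (nfloor (t * N))) in *.
  apply Rmult_le_reg_l with N; [assumption|].
  eapply Rle_trans; [exact H|].
  assert (HE : (i - t * N) * (B - A) <= 2 * L).
  { eapply Rle_trans; [apply Rle_abs|]. rewrite Rabs_mult, (Rabs_minus_sym B).
    rewrite <- (Rmult_1_l (2 * L)).
    apply Rmult_le_compat; try apply Rabs_pos; assumption. }
  apply Rmult_le_compat_l with (r := N) in HS; [|lra].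
  replace (N * (L / N)) with L in HS by (field; lra).
  unfold Rdiv. lra.
Qed.

(** Exchanging [l] and [1 - l] reduces to [a <= b]; the argument [a + l * (b - a)] is the form
    produced by [limit_sub]. *)
Lemma convex01_of_endpoints (f : R -> R) :
  (forall a b l, in01 a -> in01 b -> a <= b -> in01 l ->
     f (a + l * (b - a)) <= (1 - l) * f a + l * f b) ->
  convex01 f.
Proof.
  intros H a b l Ha Hb Hl. destruct (Rle_dec a b) as [Hab|Hab].
  - replace ((1 - l) * a + l * b) with (a + l * (b - a)) by ring. now apply H.
  - replace ((1 - l) * a + l * b) with (b + (1 - l) * (a - b)) by ring.
    assert (Hl' : in01 (1 - l)) by (unfold in01 in *; lra).
    pose proof (H b a (1 - l) Hb Ha ltac:(lra) Hl'). lra.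
Qed.

(** * The limit of the chains and its properties *)

Section LimitBicombing.
Variable U : (nat -> Prop) -> Prop.
Hypothesis HU : nonprincipal_ultrafilter U.
Variable X : MetricSpace.
Notation d := (mdist X).
Variable m : X -> X -> X.
Hypothesis Hm : conical_midpoint X m.
Hypothesis Hsym : forall x y, m x y = m y x.
Variable c : nat -> X -> X -> nat -> X.
Hypothesis Hc : forall N x y, (0 < N)%nat ->
  chain X m N (c N x y) /\ c N x y 0%nat = x /\ c N x y N = y.

Definition approx (n : nat) (x y : X) : nat -> X := c (steps n (d x y)) x y.

Variable s : X -> X -> R -> X.
Hypothesis Hs : forall x y t, in01 t ->
  ulim U X (fun n => approx n x y (nfloor (t * INR (steps n (d x y))))) (s x y t).

Lemma approx_chain (n : nat) (x y : X) :
  chain X m (steps n (d x y)) (approx n x y).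
Proof. apply Hc. unfold steps. lia. Qed.

Lemma approx_0 (n : nat) (x y : X) : approx n x y 0 = x.
Proof. apply Hc. unfold steps. lia. Qed.

Lemma approx_end (n : nat) (x y : X) : approx n x y (steps n (d x y)) = y.
Proof. apply Hc. unfold steps. lia. Qed.

Lemma approx_dist (n : nat) (x y : X) (i j : nat) :
  (i <= steps n (d x y))%nat -> (j <= steps n (d x y))%nat ->
  d (approx n x y i) (approx n x y j) =
    Rabs (INR i - INR j) * (d x y / INR (steps n (d x y))).
Proof.
  intros Hi Hj.
  rewrite (chain_geodesic X m Hm (steps n (d x y)) (approx n x y)) by
    first [assumption | apply approx_chain | unfold steps; lia].
  now rewrite approx_0, approx_end.
Qed.

(** Steps have length at most [1 / (INR n + 1)], so a bounded index error disappears in the limit.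
    The constant [K + 1] adds the rounding error of [nfloor]. *)
Lemma ulim_approx (x y : X) (t K : R) (k : nat -> nat) :
  in01 t -> (forall n, (k n <= steps n (d x y))%nat) ->
  (forall n, Rabs (INR (k n) - t * INR (steps n (d x y))) <= K) ->
  ulim U X (fun n => approx n x y (k n)) (s x y t).
Proof.
  intros Ht Hk1 Hk2.
  apply (ulim_close_rate U HU X _ _ _ (K + 1) (Hs x y t Ht)).
  intros n. destruct (frac_index n (d x y) t Ht) as [F1 F2].
  rewrite approx_dist by auto. specialize (Hk2 n).
  set (N := INR (steps n (d x y))) in *.
  set (i := nfloor (t * N)) in *.
  assert (Hd : Rabs (INR i - INR (k n)) <= K + 1).
  { replace (INR i - INR (k n)) with ((INR i - t * N) - (INR (k n) - t * N)) by ring.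
    eapply Rle_trans; [apply Rabs_triang|]. rewrite Rabs_Ropp. lra. }
  pose proof (steps_size n (d x y) (dist_ge0 X x y)) as HS. fold N in HS.
  pose proof (steps_pos n (d x y)) as HN. fold N in HN.
  apply Rmult_le_compat; [apply Rabs_pos| |assumption|assumption].
  apply Rle_mult_inv_pos; [apply dist_ge0|assumption].
Qed.

(** By [chain_dist_max] the limit does not depend on the chosen chains, and their endpoints need
    only converge. Reversed chains and subchains are treated through this. *)
Lemma ulim_chains (x y : X) (t : R) (p : nat -> nat -> X) :
  in01 t -> (forall n, chain X m (steps n (d x y)) (p n)) ->
  ulim U X (fun n => p n 0%nat) x ->
  ulim U X (fun n => p n (steps n (d x y))) y ->
  ulim U X (fun n => p n (nfloor (t * INR (steps n (d x y))))) (s x y t).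
Proof.
  intros Ht Hp H0 H1.
  apply (ulim_close U HU X _ _ _ _ _ x y (Hs x y t Ht) H0 H1).
  intros n. rewrite (dist_sym X (p n 0%nat)), (dist_sym X (p n (steps _ _))).
  pose proof (chain_dist_max X m Hm _ _ _ (approx_chain n x y) (Hp n)
    _ (proj1 (frac_index n (d x y) t Ht))) as H.
  now rewrite approx_0, approx_end in H.
Qed.

Lemma limit_0 (x y : X) : s x y 0 = x.
Proof.
  apply (ulim_unique U HU X (fun n => approx n x y 0)).
  - apply (ulim_approx x y 0 0 (fun _ => 0%nat)).
    + unfold in01; lra.
    + intros n; lia.
    + intros n. simpl. rewrite Rmult_0_l, Rminus_0_r, Rabs_R0. lra.
  - intros e He. apply (uf_all U HU). intros n. now rewrite approx_0, dist_self.
Qed.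

Lemma limit_1 (x y : X) : s x y 1 = y.
Proof.
  apply (ulim_unique U HU X (fun n => approx n x y (steps n (d x y)))).
  - apply (ulim_approx x y 1 0 (fun n => steps n (d x y))).
    + unfold in01; lra.
    + intros n; lia.
    + intros n. rewrite Rmult_1_l, Rminus_diag, Rabs_R0. lra.
  - intros e He. apply (uf_all U HU). intros n. now rewrite approx_end, dist_self.
Qed.

Lemma limit_dist (x y : X) (a b : R) :
  in01 a -> in01 b -> d (s x y a) (s x y b) = Rabs (a - b) * d x y.
Proof.
  intros Ha Hb.
  (* Along the chain the distance is exact in the indices; each of the two roundings costs at most
     one step. *)
  assert (H : forall n,
    Rabs (d (approx n x y (nfloor (a * INR (steps n (d x y)))))
            (approx n x y (nfloor (b * INR (steps n (d x y)))))
          - Rabs (a - b) * d x y) <= 2 / (INR n + 1)).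
  { intros n. destruct (frac_index n (d x y) a Ha) as [A1 A2].
    destruct (frac_index n (d x y) b Hb) as [B1 B2].
    rewrite approx_dist by assumption.
    pose proof (steps_size n (d x y) (dist_ge0 X x y)) as HS.
    pose proof (steps_pos n (d x y)) as HN. pose proof (dist_ge0 X x y) as HL.
    set (N := INR (steps n (d x y))) in *.
    set (i := INR (nfloor (a * N))) in *. set (j := INR (nfloor (b * N))) in *.
    replace (Rabs (a - b) * d x y) with (Rabs (a * N - b * N) * (d x y / N)).
    2:{ rewrite <- Rmult_minus_distr_r, Rabs_mult, (Rabs_right N) by lra.
        field; lra. }
    rewrite <- Rmult_minus_distr_r, Rabs_mult.
    assert (HP : 0 <= d x y / N) by (apply Rle_mult_inv_pos; lra).
    rewrite (Rabs_right (d x y / N)) by lra.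
    apply Rmult_le_compat; [apply Rabs_pos|assumption| |assumption].
    eapply Rle_trans; [apply Rabs_triang_inv2|].
    replace (i - j - (a * N - b * N)) with ((i - a * N) - (j - b * N)) by ring.
    eapply Rle_trans; [apply Rabs_triang|]. rewrite Rabs_Ropp. lra. }
  apply Rle_antisym.
  - apply (ulim_dist_le U HU X _ _ _ _ _ 2 (Hs x y a Ha) (Hs x y b Hb)).
    intros n. specialize (H n). apply Rabs_le_inv in H. cbv beta. lra.
  - apply (ulim_dist_ge U HU X _ _ _ _ _ 2 (Hs x y a Ha) (Hs x y b Hb)).
    intros n. specialize (H n). apply Rabs_le_inv in H. cbv beta. lra.
Qed.

Lemma limit_rev (x y : X) (t : R) : in01 t -> s y x t = s x y (1 - t).
Proof.
  intros Ht. assert (Ht' : in01 (1 - t)) by (unfold in01 in *; lra).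
  apply (ulim_unique U HU X (fun n => approx n x y
     (steps n (d x y) - nfloor (t * INR (steps n (d y x)))))).
  - apply (ulim_chains y x t (fun n j => approx n x y (steps n (d x y) - j))).
    + assumption.
    + intros n. rewrite (dist_sym X y x). apply chain_rev, approx_chain.
      exact Hsym.
    + intros e He. apply (uf_all U HU). intros n.
      now rewrite Nat.sub_0_r, approx_end, dist_self.
    + intros e He. apply (uf_all U HU). intros n.
      now rewrite (dist_sym X y x), Nat.sub_diag, approx_0, dist_self.
  - apply (ulim_approx x y (1 - t) 1); [assumption|intros n; lia|].
    intros n. rewrite (dist_sym X y x).
    destruct (frac_index n (d x y) t Ht) as [F1 F2].
    rewrite minus_INR by assumption. apply Rabs_le_inv in F2. apply Rabs_le. lra.
Qed.

(* A subarc of a limit curve is the limit of subchains. A pair of points at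
   distance [(b - a) d x y] is joined by [steps n ((b - a) d x y)] steps, so the
   subchains have to start early enough to fit in. *)
Lemma limit_sub (x y : X) (a b t : R) :
  in01 a -> in01 b -> a <= b -> in01 t ->
  s (s x y a) (s x y b) t = s x y (a + t * (b - a)).
Proof.
  intros Ha Hb Hab Ht.
  set (L := d x y). pose proof (dist_ge0 X x y) as HL. fold L in HL.
  set (p := s x y a). set (q := s x y b).
  assert (Hpq : d p q = (b - a) * L).
  { unfold p, q. rewrite limit_dist by assumption. rewrite Rabs_left1; [|lra].
    fold L. ring. }
  assert (Hc01 : in01 (a + t * (b - a))) by (unfold in01 in *; nra).
  unfold in01 in Ha, Hb.
  assert (HL' : 0 <= (b - a) * L) by nra.
  set (i := fun n => Nat.min (nfloor (a * INR (steps n L)))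
                             (steps n L - steps n (d p q))).
  assert (HNN : forall n, (steps n (d p q) <= steps n L)%nat).
  { intros n. rewrite Hpq. unfold steps. apply le_n_S, nfloor_mono.
    pose proof (pos_INR n). split; [nra|].
    apply Rmult_le_compat_r; [lra|]. nra. }
  assert (Hfit : forall n, (i n + steps n (d p q) <= steps n L)%nat).
  { intros n. specialize (HNN n). unfold i. lia. }
  assert (Hi : forall n, a * INR (steps n L) - 2 <= INR (i n) <= a * INR (steps n L)).
  { intros n. pose proof (steps_spec n L HL) as S1.
    pose proof (steps_spec n _ HL') as S2. pose proof (steps_pos n L) as S0.
    destruct (frac_index n L a Ha) as [F1 F2].
    pose proof (nfloor_spec (a * INR (steps n L)) ltac:(nra)) as F3.
    unfold i. split.
    - destruct (Nat.min_spec (nfloor (a * INR (steps n L)))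
                  (steps n L - steps n (d p q))) as [[_ ->]|[_ ->]].
      + lra.
      + rewrite minus_INR by apply HNN. rewrite Hpq.
        (* [M] is the unrounded number of steps, so that [N - M] lies between 0 and 1. *)
        set (N := INR (steps n L)) in *. set (M := L * (INR n + 1)) in *.
        replace ((b - a) * L * (INR n + 1)) with ((b - a) * M) in S2
          by (unfold M; ring).
        assert (0 <= (1 - b) * M).
        { apply Rmult_le_pos; [lra|]. unfold M. pose proof (pos_INR n). nra. }
        assert (a * (N - M) <= 1) by nra. lra.
    - apply Rle_trans with (INR (nfloor (a * INR (steps n L)))); [|lra].
      apply le_INR. lia. }
  assert (Hsteps : forall n, (b - a) * INR (steps n L) - 1 <= INR (steps n (d p q))
                      <= (b - a) * INR (steps n L) + 1).
  { intros n. pose proof (steps_spec n L HL) as S1.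
    pose proof (steps_spec n _ HL') as S2. rewrite Hpq.
    set (N := INR (steps n L)) in *. set (M := L * (INR n + 1)) in *.
    replace ((b - a) * L * (INR n + 1)) with ((b - a) * M) in S2
      by (unfold M; ring).
    assert (0 <= (b - a) * (N - M) <= 1) by nra. lra. }
  (* The same points are read once as a subchain from near [p] to near [q] and once inside the whole
     chain. The index error is 2 at the start and 3 at the end, where the step count adds 1; for
     general [t] it is 4, since rounding adds 1 more. *)
  apply (ulim_unique U HU X (fun n => approx n x y
           (i n + nfloor (t * INR (steps n (d p q)))))).
  - apply (ulim_chains p q t (fun n j => approx n x y (i n + j)%nat)).
    + assumption.
    + intros n. eapply chain_sub; [apply approx_chain|apply Hfit].
    + apply (ulim_approx x y a 2); [exact Ha| |].
      * intros n. fold L. specialize (Hfit n). lia.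
      * intros n. fold L. rewrite Nat.add_0_r. specialize (Hi n).
        apply Rabs_le. lra.
    + apply (ulim_approx x y b 3); [exact Hb|exact Hfit|].
      intros n. fold L. rewrite plus_INR. specialize (Hi n). specialize (Hsteps n).
      apply Rabs_le. lra.
  - apply (ulim_approx x y (a + t * (b - a)) 4); [assumption| |].
    + intros n. fold L. specialize (Hfit n).
      pose proof (proj1 (frac_index n (d p q) t Ht)). lia.
    + intros n. fold L. rewrite plus_INR. specialize (Hi n). specialize (Hsteps n).
      pose proof (proj2 (frac_index n (d p q) t Ht)) as F. apply Rabs_le_inv in F.
      unfold in01 in Ht.
      set (N := INR (steps n L)) in *. set (K := INR (steps n (d p q))) in *.
      assert (-1 <= t * (K - (b - a) * N) <= 1) by nra.
      apply Rabs_le. lra.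
Qed.

Lemma limit_geodesic : bicombing X s.
Proof.
  intros x y. split; [apply limit_0|]. split; [apply limit_1|].
  intros a b. apply limit_dist.
Qed.

(** Points taken in order are covered by [limit_sub]; the opposite order is reduced to it by
    [limit_rev], where the symmetry of [m] enters. *)
Lemma limit_consistent : consistent X s.
Proof.
  assert (Hle : forall x y a b, in01 a -> in01 b -> a <= b -> forall z,
            image01 X (s (s x y a) (s x y b)) z -> image01 X (s x y) z).
  { intros x y a b Ha Hb Hab z [t [Ht <-]].
    exists (a + t * (b - a)). split; [unfold in01 in *; nra|].
    now rewrite limit_sub. }
  intros x y p q [a [Ha <-]] [b [Hb <-]] z Hz.
  destruct (Rle_dec a b) as [Hab|Hab]; [now apply (Hle x y a b)|].
  apply (Hle x y b a); [assumption|assumption|lra|].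
  destruct Hz as [t [Ht <-]]. exists (1 - t). split; [unfold in01 in *; lra|].
  symmetry. now apply limit_rev.
Qed.

(** Equal distances give equal values of [steps n], so the two chains can be compared index by index
    before the limit is taken. *)
Lemma limit_conical_eq_length (x y x' y' : X) (t : R) :
  d x y = d x' y' -> in01 t ->
  d (s x y t) (s x' y' t) <= (1 - t) * d x x' + t * d y y'.
Proof.
  intros HL Ht. apply (ulim_dist_le U HU X _ _ _ _ _ 2 (Hs x y t Ht) (Hs x' y' t Ht)).
  intros n. cbv beta. rewrite <- HL.
  apply (interpolation_error n (d x y)); [apply dist_ge0|assumption| |].
  - pose proof (dist_tri X x y x') as T1. pose proof (dist_tri X y y' x') as T2.
    pose proof (dist_tri X y x y') as T3. pose proof (dist_tri X x x' y') as T4.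
    rewrite (dist_sym X y' x') in T2. rewrite (dist_sym X y x) in T3.
    apply Rabs_le. lra.
  - pose proof (approx_chain n x' y') as C'. pose proof (approx_0 n x' y') as E0.
    pose proof (approx_end n x' y') as E1. rewrite <- HL in C', E1.
    pose proof (chain_dist_convex X m Hm _ _ _ (approx_chain n x y) C'
      _ (proj1 (frac_index n (d x y) t Ht))) as H.
    now rewrite !approx_0, approx_end, E1 in H.
Qed.

Lemma limit_dist_point (x y z : X) (t : R) :
  in01 t -> d z (s x y t) <= (1 - t) * d z x + t * d z y.
Proof.
  intros Ht.
  apply (ulim_dist_le U HU X _ _ _ _ _ 2 (ulim_const U HU X z) (Hs x y t Ht)).
  intros n. cbv beta.
  apply (interpolation_error n (d x y)); [apply dist_ge0|assumption| |].
  - pose proof (dist_tri X z x y). pose proof (dist_tri X z y x).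
    pose proof (dist_ge0 X x y). rewrite (dist_sym X y x) in *.
    apply Rabs_le. lra.
  - pose proof (chain_dist_point_convex X m Hm _ _ z (approx_chain n x y)
      _ (proj1 (frac_index n (d x y) t Ht))) as H.
    now rewrite approx_0, approx_end in H.
Qed.

Lemma limit_straight (x y : X) : straight X (s x y).
Proof.
  intros z. apply convex01_of_endpoints. intros a b l Ha Hb Hab Hl.
  rewrite <- limit_sub by assumption. now apply limit_dist_point.
Qed.

(** Subarcs over the same parameter interval again have equal lengths, so the inequality at the
    endpoints applies to each of them. *)
Lemma limit_convex_eq_length (x y x' y' : X) :
  d x y = d x' y' -> convex01 (fun t => d (s x y t) (s x' y' t)).
Proof.
  intros HL. apply convex01_of_endpoints. intros a b l Ha Hb Hab Hl.
  rewrite <- !limit_sub by assumption.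
  apply limit_conical_eq_length; [|assumption].
  rewrite !limit_dist by assumption. now rewrite HL.
Qed.

End LimitBicombing.

(** * From a conical bicombing to the limit bicombing *)

Lemma conical_bicombing_midpoint (X : MetricSpace) (sigma : X -> X -> R -> X) :
  bicombing X sigma -> conical X sigma ->
  conical_midpoint X (fun x y => sigma x y (1 / 2)).
Proof.
  intros Hb Hcon.
  assert (H0 : in01 0) by (unfold in01; lra).
  assert (H1 : in01 1) by (unfold in01; lra).
  assert (H2 : in01 (1 / 2)) by (unfold in01; lra).
  split.
  - intros x y. destruct (Hb x y) as [E0 [E1 E]].
    rewrite <- E0 at 1. rewrite E by assumption. rewrite Rabs_left by lra. lra.
  - intros x y. destruct (Hb x y) as [E0 [E1 E]].
    rewrite <- E1 at 2. rewrite E by assumption. rewrite Rabs_left by lra. lra.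
  - intros x y x' y'. pose proof (Hcon x y x' y' (1 / 2) H2). lra.
Qed.

Theorem theorem1p5 (X : MetricSpace) :
  proper X ->
  (exists sigma : X -> X -> R -> X, bicombing X sigma /\ conical X sigma) ->
  exists s : X -> X -> R -> X,
    bicombing X s /\
    consistent X s /\
    (forall x y : X, straight X (s x y)) /\
    (forall x y x' y' : X, mdist X x y = mdist X x' y' ->
       convex01 (fun t => mdist X (s x y t) (s x' y' t))).
Proof.
  intros HX [sigma [Hb Hcon]].
  destruct nonprincipal_ultrafilter_exists as [U HU].
  destruct (symmetric_midpoint_exists U HU X _ HX
              (conical_bicombing_midpoint X sigma Hb Hcon)) as [m [Hm Hsym]].
  assert (Hchain : forall N x y, exists p, (0 < N)%nat ->
            chain X m N p /\ p 0%nat = x /\ p N = y).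
  { intros N x y. destruct (Nat.eq_dec N 0) as [->|HN].
    (* A dummy value: no chain with 0 steps joins distinct points. *)
    - exists (fun _ => x). intros C; inversion C.
    - destruct (chain_exists U HU X m Hm N x y HX ltac:(lia)) as [p Hp]. eauto. }
  set (c := fun N x y =>
              proj1_sig (constructive_indefinite_description _ (Hchain N x y))).
  assert (Hc : forall N x y, (0 < N)%nat ->
            chain X m N (c N x y) /\ c N x y 0%nat = x /\ c N x y N = y).
  { intros N x y. unfold c.
    now destruct (constructive_indefinite_description _ _). }
  assert (Hlim : forall x y t, exists l, in01 t -> ulim U X (fun n =>
            approx X c n x y (nfloor (t * INR (steps n (mdist X x y))))) l).
  { intros x y t. destruct (classic (in01 t)) as [Ht|Ht].
    (* Outside the unit interval the value is arbitrary. *)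
    2:{ exists x. intros C; contradiction. }
    destruct (ulim_exists U HU X
      (fun n => approx X c n x y (nfloor (t * INR (steps n (mdist X x y)))))
      x (mdist X x y) HX) as [l Hl]; [|eauto].
    (* Chains are discrete geodesics, so their points stay within [mdist X x y] of [x] and the limit
       exists. *)
    intros n. destruct (frac_index n (mdist X x y) t Ht) as [F _].
    rewrite <- (approx_0 X m c Hc n x y) at 1.
    rewrite (approx_dist X m Hm c Hc) by (assumption || lia).
    apply le_INR in F. set (i := nfloor _) in *. simpl (INR 0).
    pose proof (steps_pos n (mdist X x y)) as HN.
    pose proof (pos_INR i). rewrite Rminus_0_l, Rabs_Ropp, Rabs_right by lra.
    pose proof (dist_ge0 X x y).
    apply Rmult_le_reg_r with (INR (steps n (mdist X x y))); [assumption|].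
    replace (INR i * (mdist X x y / INR (steps n (mdist X x y))) *
              INR (steps n (mdist X x y))) with (INR i * mdist X x y)
      by (field; lra).
    nra. }
  set (s := fun x y t =>
              proj1_sig (constructive_indefinite_description _ (Hlim x y t))).
  assert (Hs : forall x y t, in01 t -> ulim U X (fun n =>
            approx X c n x y (nfloor (t * INR (steps n (mdist X x y))))) (s x y t)).
  { intros x y t. unfold s.
    now destruct (constructive_indefinite_description _ _). }
  exists s. split; [|split; [|split]].
  - exact (limit_geodesic U HU X m Hm c Hc s Hs).
  - exact (limit_consistent U HU X m Hm Hsym c Hc s Hs).
  - exact (limit_straight U HU X m Hm c Hc s Hs).
  - exact (limit_convex_eq_length U HU X m Hm c Hc s Hs).
Qed.
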